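(* Consider the Bayesian game described in the context. Suppose that for $i\in N$, $u_i(a,\theta)$ is Lipschitz continuous over $\mathcal{A}\times\Theta$ and that for each $f_{-i}\in\mathcal{F}_{-i}$ and $\theta\in\Theta$, $u_i(\cdot,f_{-i}(\theta_{-i}),\theta):\mathcal{A}_i\to\mathbb{R}$ is strongly concave on $\mathcal{A}_i$, i.e., there exists a positive constant $\sigma_i$ (uniform with respect to $f_{-i}$ and $\theta$) such that $$u_i(ta_i'+(1-t)a_i,f_{-i}(\theta_{-i}),\theta_i,\theta_{-i})\ \ge\ t\,u_i(a_i',f_{-i}(\theta_{-i}),\theta_i,\theta_{-i})+(1-t)\,u_i(a_i,f_{-i}(\theta_{-i}),\theta_i,\theta_{-i})+\frac{\sigma_i}{2}t(1-t)\|a_i'-a_i\|^2$$ for all $a_i,a_i'\in\mathcal{A}_i$, $t\in[0,1]$. Suppose that $\mathcal{A}$ is a convex set. Then $-\rho_i$ satisfies the second order growth condition: there exists a constant $\alpha>0$ such that for all $i\in N$, $f_{-i}\in\mathcal{F}_{-i}$ and $\theta_i\in\Theta_i$, $$-\rho_i(a_i',f_{-i},\theta_i)\ \ge\ -v_i(f_{-i},\theta_i)+\alpha\,d\big(a_i',A_i^*(f_{-i},\theta_i)\big)^2,\qquad\forall a_i'\in\mathcal{A}_i,$$ where $v_i(f_{-i},\theta_i):=\max_{a_i\in\mathcal{A}_i}\rho_i(a_i,f_{-i},\theta_i)$ and $A_i^*(f_{-i},\theta_i):=\arg\max_{a_i\in\mathcal{A}_i}\rho_i(a_i,f_{-i}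,\theta_i)$.
   Context: Bayesian game: there are $n$ players, $N=\{1,\ldots,n\}$. For each $i$, the type set $\Theta_i\subset\mathbb{R}^{d_i}$ and the action space $\mathcal{A}_i\subset\mathbb{R}^{z_i}$ are non-empty, compact and convex. Put $\Theta=\Theta_1\times\cdots\times\Theta_n$, $\mathcal{A}=\mathcal{A}_1\times\cdots\times\mathcal{A}_n$; the subscript $-i$ denotes the vector (or product) over all players except $i$. Player $i$ has utility $u_i(a,\theta)=u_i(a_i,a_{-i},\theta_i,\theta_{-i})$. The types $\theta$ have joint probability distribution $\eta$ on $\Theta$; $\eta_i(\cdot|\theta_i)$ denotes the conditional probability distribution of $\theta_{-i}$ on $\Theta_{-i}$ given $\theta_i$ (specified for every $\theta_i\in\Theta_i$). $\mathcal{F}_i$ is the set of (measurable) functions $f_i:\Theta_i\to\mathcal{A}_i$, and $\mathcal{F}_{-i}=\prod_{j\ne i}\mathcal{F}_j$. For $a_i\in\mathcal{A}_i$, $f_{-i}\in\mathcal{F}_{-i}$, $\theta_i\in\Theta_i$, $$\rho_i(a_i,f_{-i},\theta_i):=\int_{\Theta_{-i}}u_i(a_i,f_{-i}(\theta_{-i}),\theta_i,\theta_{-i})\,d\eta_i(\theta_{-i}|\theta_i).$$ $\|\cdot\|$ is the Euclidean norm and $d(x,B)=\inf_{b\in B}\|x-b\|$. *)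

(* Defs.v *)
From HB Require Import structures.
From mathcomp Require Import all_boot all_order all_algebra.
From mathcomp Require Import all_classical all_reals all_analysis.
From mathcomp Require Import measurable_realfun.

Set Implicit Arguments.
Unset Strict Implicit.
Unset Printing Implicit Defensive.

Import Order.TTheory GRing.Theory Num.Theory.
Import numFieldNormedType.Exports.

Local Open Scope classical_set_scope.
Local Open Scope ring_scope.

Section euclidean.
Context {R : realType}.

(* The library norm on 'rV[R]_k is the sup norm. *)
Definition enorm k (x : 'rV[R]_k) : R := Num.sqrt (\sum_j x ord0 j ^+ 2).

(* Only meaningful for nonempty B: the real infimum of set0 is 0. *)
Definition dist_set k (x : 'rV[R]_k) (B : set 'rV[R]_k) : R :=
  inf [set enorm (x - b) | b in B].

End euclidean.

(* The Borel sigma-algebra of a topological space. *)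
Definition borel (T : ptopologicalType) := g_sigma_algebraType (@open T).

Section products.
Context (R : realType) (I : finType) (k : I -> nat).

(* The product over j : I of the spaces R^(k j), with the product topology. *)
Definition prodRV := prod_topology (fun j : I => 'rV[R]_(k j)).

HB.instance Definition _ := Topological.on prodRV.
HB.instance Definition _ := Pointed.copy prodRV (forall j, 'rV[R]_(k j)).

Definition boxRV (S : forall j, set 'rV[R]_(k j)) : set prodRV :=
  [set x | forall j, S j (x j)].

Definition sqnormRV (x : prodRV) : R := \sum_j enorm (x j) ^+ 2.

Definition subRV (x y : prodRV) : prodRV := fun j => x j - y j.

Definition convRV (t : R) (x y : prodRV) : prodRV :=
  fun j => t *: x j + (1 - t) *: y j.

End products.

Section players.
Context (R : realType) {n : nat}.
Implicit Types (k : 'I_n -> nat) (i : 'I_n).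

Definition others i : finType := {j : 'I_n | j != i}.

Definition profile k := prodRV R k.

Definition others_profile k i := prodRV R (fun j : others i => k (val j)).

Definition proj_others k i (x : profile k) : others_profile k i :=
  fun j => x (val j).

Definition box_others k i (S : forall j, set 'rV[R]_(k j)) :
  set (others_profile k i) := boxRV (fun j : others i => S (val j)).

End players.

Arguments proj_others {R n k} i x.
Arguments box_others {R n k i} S.

Unset Implicit Arguments.

(* The utility u_i(a_i, a_{-i}, theta_i, theta_{-i}) takes the own and the other
   components as separate arguments.  [belief i t] is the conditional
   distribution eta_i(. | t) of theta_{-i} given theta_i = t; its values at
   types t outside [types i] are irrelevant. *)
Record bayesian_game (R : realType) (n : nat) := BayesianGame {
  tdim : 'I_n -> nat ;
  adim : 'I_n -> nat ;
  types : forall i, set 'rV[R]_(tdim i) ;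
  actions : forall i, set 'rV[R]_(adim i) ;
  utility : forall i, 'rV[R]_(adim i) -> others_profile R adim i ->
                      'rV[R]_(tdim i) -> others_profile R tdim i -> R ;
  prior : probability (borel (profile R tdim)) R ;
  belief : forall i, 'rV[R]_(tdim i) ->
                     probability (borel (others_profile R tdim i)) R ;
  types_neq0 : forall i, types i !=set0 ;
  types_compact : forall i, compact (types i) ;
  types_convex : forall i, convex_set (types i) ;
  actions_neq0 : forall i, actions i !=set0 ;
  actions_compact : forall i, compact (actions i) ;
  actions_convex : forall i, convex_set (actions i) ;
  prior_types : prior (boxRV types) = 1%E ;
  belief_types : forall i t, types i t ->
    belief i t (box_others types) = 1%E ;
  measurable_belief : forall i (C : set (borel (others_profile R tdim i))),
    measurable C ->
    measurable_fun (types i : set (borel 'rV[R]_(tdim i)))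
      (fun t => belief i t C) ;
  belief_conditional : forall i (B : set (borel 'rV[R]_(tdim i)))
      (C : set (borel (others_profile R tdim i))),
    measurable B -> measurable C -> B `<=` types i ->
    prior [set x : profile R tdim | B (x i) /\ C (proj_others i x)] =
    (\int[prior]_(x in [set x : profile R tdim | B (x i)])
        belief i (x i) C)%E
}.

Set Implicit Arguments.

Arguments BayesianGame {R n}.
Arguments tdim {R n} G i : rename.
Arguments adim {R n} G i : rename.
Arguments types {R n} G i _ : rename.
Arguments actions {R n} G i _ : rename.
Arguments utility {R n} G i _ _ _ _ : rename.
Arguments prior {R n} G : rename.
Arguments belief {R n} G i _ : rename.

Section game.
Context {R : realType} {n : nat} (G : bayesian_game R n).
Local Notation Th := (types G).
Local Notation A := (actions G).

(* Elements of F_i are total functions; only their values on Theta_i matter. *)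
Definition strategies i :
    set ('rV[R]_(tdim G i) -> 'rV[R]_(adim G i)) :=
  [set f | (forall t, Th i t -> A i (f t)) /\
    measurable_fun (Th i : set (borel 'rV[R]_(tdim G i)))
      (f : borel 'rV[R]_(tdim G i) -> borel 'rV[R]_(adim G i))].

Definition others_strategy i :=
  forall j : others i, 'rV[R]_(tdim G (val j)) -> 'rV[R]_(adim G (val j)).

Definition others_strategies i : set (others_strategy i) :=
  [set f | forall j, strategies (f j)].

Definition play i (f : others_strategy i) (x : others_profile R (tdim G) i) :
  others_profile R (adim G) i := fun j => f j (x j).

Definition lipschitz_utility i := exists L : R,
  forall (a b : profile R (adim G)) (x y : profile R (tdim G)),
    boxRV A a -> boxRV A b -> boxRV Th x -> boxRV Th y ->
    `|utility G i (a i) (proj_others i a) (x i) (proj_others i x) -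
      utility G i (b i) (proj_others i b) (y i) (proj_others i y)| <=
    L * Num.sqrt (sqnormRV (subRV a b) + sqnormRV (subRV x y)).

Definition strongly_concave_utility i := exists2 sigma : R, 0 < sigma &
  forall (f : others_strategy i) (x : profile R (tdim G)),
    others_strategies f -> boxRV Th x ->
    let u a := utility G i a (play f (proj_others i x)) (x i) (proj_others i x) in
    forall (a a' : 'rV[R]_(adim G i)) (t : R),
      A i a -> A i a' -> 0 <= t <= 1 ->
      u (t *: a' + (1 - t) *: a) >=
        t * u a' + (1 - t) * u a
        + sigma / 2 * t * (1 - t) * enorm (a' - a) ^+ 2.

Definition convex_action_profiles :=
  forall (a b : profile R (adim G)) (t : R),
    boxRV A a -> boxRV A b -> 0 <= t <= 1 -> boxRV A (convRV t a b).

Definition rho i (a : 'rV[R]_(adim G i)) (f : others_strategy i)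
    (t : 'rV[R]_(tdim G i)) : R :=
  \int[belief G i t]_(x in box_others Th) utility G i a (play f x) t x.

(* The maximum of rho over A_i, provided it is attained. *)
Definition opt_value i (f : others_strategy i) (t : 'rV[R]_(tdim G i)) : R :=
  sup [set rho a f t | a in A i].

Definition opt_actions i (f : others_strategy i) (t : 'rV[R]_(tdim G i)) :
    set 'rV[R]_(adim G i) :=
  [set a | A i a /\ forall b, A i b -> rho b f t <= rho a f t].

End game.

(* Main.v *)
Require Import Defs.
From HB Require Import structures.
From mathcomp Require Import all_boot all_order all_algebra.
From mathcomp Require Import all_classical all_reals all_analysis.
From mathcomp Require Import measurable_realfun lra.

Set Implicit Arguments.
Unset Strict Implicit.
Unset Printing Implicit Defensive.

Import Order.TTheory GRing.Theory Num.Theory.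
Import numFieldNormedType.Exports.

Local Open Scope classical_set_scope.
Local Open Scope ring_scope.

(** Strong concavity survives integration against a
    probability measure, so [rho] is strongly concave in the own action with
    the modulus [sigma] of the utility.  Compare a maximiser [b] of [rho] with
    any other action [a] through their midpoint:
      [rho b >= rho ((a + b) / 2)
             >= (rho a + rho b) / 2 + sigma / 8 * |a - b|^2],
    which rearranges to [rho b >= rho a + sigma / 4 * |a - b|^2]
    ([strongly_concave_growth]).  The distance from [a] to the argmax is at
    most [|a - b|], and the least of the finitely many constants
    [sigma_i / 4] serves all players ([second_order_growth]).

    The analytic work is to show that the integral defining [rho] behaves like
    an integral: [integrable_utility] says that the integrand
    [x |-> u a (f x) t x] is bounded and measurable.  Boundedness follows from
    the Lipschitz condition on a compact box.  Measurability is delicate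
    because the strategies are only Borel maps; it would normally go through
    the identification of the Borel sigma-algebra of a finite product with the
    product sigma-algebra.  Here [measurable_fun_of_coords] replaces that
    identification: the integrand depends continuously on the finitely many
    real coordinates of [x] and [f x], each of which is measurable in [x].

    Integrability also makes [rho] Lipschitz in the own action, and the extreme
    value theorem on the compact action set gives a maximiser
    ([opt_actions_neq0]).

    The utility takes a player's own components apart from those of the others,
    while its hypotheses speak of full profiles; [profile_of] reassembles a
    profile from the two parts. *)

(** * Functions of finitely many measurable coordinates *)

(** A function that is continuous relative to finitely many measurable real
    functions is measurable: the set [h < v] is the union of those cells, cut
    out by rational points and radii [1 / m.+1] in the coordinates, on which
    [h < v] throughout.  There are countably many cells, and continuity puts
    each point of the set in one of them. *)
Lemma measurable_fun_of_coords d (X : measurableType d) (R : realType)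
    (C : finType) (B : set X) (phi : C -> X -> R) (h : X -> R) :
  measurable B -> (forall c, measurable_fun B (phi c)) ->
  (forall x e, B x -> 0 < e -> exists2 r, 0 < r & forall y, B y ->
    (forall c, `|phi c y - phi c x| <= r) -> `|h y - h x| <= e) ->
  measurable_fun B h.
Proof.
move=> mB mphi hphi _.
apply: (measurability _ (RGenInftyO.measurableE R)) => //.
move=> _ [_ [v ->] <-].
pose cell (q : {ffun C -> rat} * nat) : set X :=
  B `&` \bigcap_c (B `&` phi c @^-1`
    `](ratr (q.1 c) - q.2.+1%:R^-1), (ratr (q.1 c) + q.2.+1%:R^-1)[).
have mcell q : measurable (cell q).
  apply: measurableI => //; apply: fin_bigcap_measurable => // c _.
  exact: mphi.
have -> : B `&` h @^-1` `]-oo, v[ =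
    \bigcup_q (if `[< cell q `<=` h @^-1` `]-oo, v[ >] then cell q else set0).
  apply/seteqP; split => [x [Bx]|x [q _]]; last first.
    by case: asboolP => // qv qx; split; [case: qx | exact: qv].
  rewrite /= in_itv/= => hv.
  have e0 : 0 < (v - h x) / 2 by rewrite divr_gt0 ?subr_gt0.
  have [r r0 hr] := hphi x _ Bx e0.
  have r20 : 0 < r / 2 by rewrite divr_gt0.
  pose m := Num.truncn (r / 2)^-1.
  have mr : m.+1%:R^-1 < r / 2.
    by rewrite -[ltRHS]invrK ltf_pV2 ?posrE ?invr_gt0// truncnS_gt.
  have m0 : 0 < m.+1%:R^-1 :> R by rewrite invr_gt0.
  set w := m.+1%:R^-1 in mr m0.
  have /choice[q qP] : forall c, exists q : rat,
      ratr q \in `](phi c x - w), (phi c x + w)[.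
    by move=> c; apply: rat_in_itvoo; lra.
  exists ([ffun c => q c], m) => //.
  (* Points of this cell lie within 2w < r of x in each coordinate. *)
  case: asboolP => [_|[]].
    split=> // c _; split=> //=; rewrite in_itv/= ffunE -/w.
    by have := qP c; rewrite in_itv/=; lra.
  move=> y [By yq]; rewrite /= in_itv/=.
  have : `|h y - h x| <= (v - h x) / 2.
    apply: hr => // c; have [_] := yq c I; have := qP c.
    by rewrite /= !in_itv/= ffunE -/w ler_norml; lra.
  by rewrite ler_norml; lra.
apply: countable_bigcupT_measurable => [|q]; first exact: countableP.
by case: ifPn => // _; exact: measurable0.
Qed.

(** * Euclidean norm, sup norm and compact boxes *)

Lemma rv_norm_leP (R : realType) k (x : 'rV[R]_k) (r : R) : 0 <= r ->
  `|x| <= r <-> forall l, `|x ord0 l| <= r.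
Proof.
move=> r0; rewrite [`|x|]mx_normrE; split=> [xr l|xr].
  apply: le_trans xr.
  exact: (le_bigmax _ (fun ij => `|x ij.1 ij.2|) (ord0, l)).
by apply/bigmax_leP; split=> // -[i l] _; rewrite ord1 xr.
Qed.

Lemma enorm_ge0 (R : realType) k (x : 'rV[R]_k) : 0 <= enorm x.
Proof. exact: sqrtr_ge0. Qed.

Lemma enorm_sq_le (R : realType) k (x : 'rV[R]_k) (r : R) : 0 <= r ->
  `|x| <= r -> enorm x ^+ 2 <= k%:R * r ^+ 2.
Proof.
move=> r0 /rv_norm_leP -/(_ r0) xr.
rewrite sqr_sqrtr ?sumr_ge0// => [|l _]; last first.
  exact: sqr_ge0.
rewrite -[k in k%:R]card_ord mulr_natl -sumr_const ler_sum// => l _.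
by rewrite -real_normK ?num_real// lerXn2r ?nnegrE ?(le_trans _ (xr l)).
Qed.

Lemma sqnormRV_le (R : realType) (I : finType) (k : I -> nat) (x : prodRV R k)
    (r : R) : 0 <= r -> (forall j, `|x j| <= r) ->
  sqnormRV x <= (\sum_j k j)%:R * r ^+ 2.
Proof.
move=> r0 xr; rewrite natr_sum mulr_suml ler_sum// => j _.
exact: enorm_sq_le.
Qed.

Lemma compact_boxRV_bounded (R : realType) (I : finType) (k : I -> nat)
    (S : forall j, set 'rV[R]_(k j)) : (forall j, compact (S j)) ->
  exists2 M, 0 <= M & forall x, boxRV S x -> forall j, `|x j| <= M.
Proof.
move=> cS.
have /choice[M SM] : forall j, exists M, 0 <= M /\ forall x, S j x -> `|x| <= M.
  move=> j; have [M [_ SM]] := compact_bounded (cS j).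
  exists (`|M| + 1); split=> [|x Sx]; first by rewrite addr_ge0.
  by apply: SM => //; rewrite ltr_pwDr// ler_norm.
exists (\sum_j M j); first by apply: sumr_ge0 => j _; case: (SM j).
move=> x Sx j; rewrite (bigD1 j)//= -[leLHS]addr0 lerD//.
  by case: (SM j) => _; apply.
by apply: sumr_ge0 => l _; case: (SM l).
Qed.

(** * Own and others' components of a profile *)

Lemma own_others_ind n (i : 'I_n) (P : 'I_n -> Prop) :
  P i -> (forall j : others i, P (val j)) -> forall j, P j.
Proof.
move=> Pi Po j; case: (eqVneq j i) => [->//|ji].
exact: (Po (Sub j ji)).
Qed.

(** The own and the others' components of a profile can be prescribed
    independently; this is what lets hypotheses on full profiles be applied to
    a utility whose arguments are already split. *)
Lemma profile_of (R : realType) n (k : 'I_n -> nat) (i : 'I_n)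
    (t : 'rV[R]_(k i)) (x : others_profile R k i) :
  exists p : profile R k, p i = t /\ proj_others i p = x.
Proof.
exists (fun j => match pselect (j = i) with
  | left e => ecast l 'rV[R]_(k l) (esym e) t
  | right ne => x (Sub j (introN eqP ne)) end); split.
  by case: pselect => // e; rewrite eq_axiomK.
apply: functional_extensionality_dep => -[j ji]; rewrite /proj_others /=.
case: pselect => [e|ne]; first by case/eqP: (ji).
by rewrite (bool_irrelevance (introN eqP ne) ji).
Qed.

Lemma boxRV_others (R : realType) n (k : 'I_n -> nat) (i : 'I_n)
    (S : forall j, set 'rV[R]_(k j)) (p : profile R k) :
  S i (p i) -> box_others S (proj_others i p) -> boxRV S p.
Proof.
by move=> Si So; apply: (own_others_ind (i := i)) => // j; exact: So.
Qed.

(** * Borel sets and maps *)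

Lemma continuous_borel_measurable (T U : ptopologicalType) (f : T -> U) :
  continuous f -> measurable_fun setT (f : borel T -> borel U).
Proof.
move=> /continuousP cf.
apply: (@measurability _ _ (borel T) (borel U) _ f (@open U) erefl).
move=> _ [V oV <-].
by rewrite setTI; apply: sub_sigma_algebra; exact: cf.
Qed.

(** The measurable structure of the reals is generated by half-open intervals,
    not by the open sets; the two sigma-algebras agree. *)
Lemma borel_measurable_fun (R : realType) d (X : measurableType d) (B : set X)
    (f : X -> R) :
  measurable_fun B (f : X -> borel R) -> measurable_fun B f.
Proof.
move=> mf mB; apply: (measurability _ (RGenOpens.measurableE R)) => //.
move=> _ [_ [a [b ->]] <-]; apply: mf => //.
by apply: sub_sigma_algebra; exact: interval_open.
Qed.

Lemma boxRV_closed (R : realType) (I : finType) (k : I -> nat)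
    (S : forall j, set 'rV[R]_(k j)) :
  (forall j, closed (S j)) -> closed (boxRV S).
Proof.
move=> cS.
have -> : boxRV S = \bigcap_j (@proj _ (fun j => 'rV[R]_(k j)) j @^-1` S j).
  by apply/seteqP; split=> x /= Sx j => [_|]; exact: Sx.
apply: closed_bigI => j _; apply: closed_comp => // x _.
exact: proj_continuous.
Qed.

Lemma closed_borel_measurable (T : ptopologicalType) (A : set T) :
  closed A -> measurable (A : set (borel T)).
Proof.
move=> cA; rewrite -(setCK A); apply: measurableC.
by apply: sub_sigma_algebra; exact: closed_openC.
Qed.

(** * Strong concavity and quadratic growth *)

Definition strongly_concave_on (R : realType) k (S : set 'rV[R]_k) (sigma : R)
    (g : 'rV[R]_k -> R) :=
  forall a a' s, S a -> S a' -> 0 <= s <= 1 ->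
    s * g a' + (1 - s) * g a + sigma / 2 * s * (1 - s) * enorm (a' - a) ^+ 2
    <= g (s *: a' + (1 - s) *: a).

(** Comparing [b] with the midpoint of [a] and [b] loses a factor 2 against the
    optimal constant [sigma / 2], which the limit of the points
    [s *: a + (1 - s) *: b] as [s] tends to 0 would give; any positive constant
    suffices. *)
Lemma strongly_concave_growth (R : realType) k (S : set 'rV[R]_k) (sigma : R)
    (g : 'rV[R]_k -> R) (b : 'rV[R]_k) :
  (forall x y s, S x -> S y -> 0 <= s <= 1 -> S (s *: x + (1 - s) *: y)) ->
  strongly_concave_on S sigma g ->
  S b -> (forall x, S x -> g x <= g b) ->
  forall a, S a -> g a + sigma / 4 * enorm (a - b) ^+ 2 <= g b.
Proof.
move=> cS gc Sb bmax a Sa.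
have half01 : 0 <= (2^-1 : R) <= 1 by lra.
have := gc b a _ Sb Sa half01; have := bmax _ (cS _ _ _ Sa Sb half01).
by set e := enorm _ ^+ 2; set m := g (_ + _); lra.
Qed.

(** * Regularity of the utility and of its expectation *)

Section game_lemmas.
Context (R : realType) (n : nat) (G : bayesian_game R n) (i : 'I_n).
Local Notation Th := (types G).
Local Notation A := (actions G).
Local Notation u := (utility G i).

(** The Lipschitz condition in terms of sup norms and of split profiles.  If
    every block moves by at most [r], each of the [N] real coordinates does,
    so the Euclidean distance is at most [sqrt N * r].  The added 1 only makes
    [K] positive, so that one can divide by it. *)
Lemma utility_lipschitz_supnorm : lipschitz_utility G i ->
  exists2 K, 0 < K & forall a a' b b' t x x' r,
    A i a -> A i a' -> box_others A b -> box_others A b' ->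
    Th i t -> box_others Th x -> box_others Th x' ->
    `|a - a'| <= r -> (forall j, `|b j - b' j| <= r) ->
    (forall j, `|x j - x' j| <= r) ->
    `|u a b t x - u a' b' t x'| <= K * r.
Proof.
move=> [L Lu].
pose N := (\sum_j adim G j)%N + (\sum_j tdim G j)%N.
exists (`|L| * Num.sqrt N%:R + 1).
  by rewrite ltr_wpDl// mulr_ge0// sqrtr_ge0.
move=> a a' b b' t x x' r Aa Aa' Ab Ab' Tt Tx Tx' ra rb rx.
have r0 : 0 <= r by exact: le_trans ra.
have [p [pi po]] := profile_of a b.
have [p' [pi' po']] := profile_of a' b'.
have [q [qi qo]] := profile_of t x.
have [q' [qi' qo']] := profile_of t x'.
have := Lu p p' q q'.
rewrite pi po pi' po' qi qo qi' qo' => /(_ _ _ _ _)/le_trans; apply.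
- by apply: (boxRV_others (i := i)); rewrite ?pi ?po.
- by apply: (boxRV_others (i := i)); rewrite ?pi' ?po'.
- by apply: (boxRV_others (i := i)); rewrite ?qi ?qo.
- by apply: (boxRV_others (i := i)); rewrite ?qi' ?qo'.
apply: (@le_trans _ _ (`|L| * (Num.sqrt N%:R * r))); last first.
  by rewrite mulrA ler_wpM2r// lerDl.
apply: le_trans (ler_wpM2r _ (ler_norm L)) _; first exact: sqrtr_ge0.
rewrite ler_wpM2l//.
rewrite -[X in _ * X]ger0_norm// -sqrtr_sqr -sqrtrM//.
rewrite ler_wsqrtr// natrD mulrDl lerD// sqnormRV_le//.
- apply: (own_others_ind (i := i)) => [|j]; first by rewrite /subRV pi pi'.
  by move: (rb j); rewrite -po -po'.
- apply: (own_others_ind (i := i)) => [|j].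
    by rewrite /subRV qi qi' subrr normr0.
  by move: (rx j); rewrite -qo -qo'.
Qed.

(** A point of one action set extends to a profile of actions, since no action
    set is empty; convexity of the product therefore passes to each factor. *)
Lemma convex_actions a b s : convex_action_profiles G ->
  A i a -> A i b -> 0 <= s <= 1 -> A i (s *: a + (1 - s) *: b).
Proof.
move=> A_convex Aa Ab s01.
pose z : others_profile R (adim G) i :=
  fun j => projT1 (cid (@actions_neq0 _ _ G (val j))).
have Az : box_others A z by move=> j; rewrite /z; case: cid.
have [p [pa pz]] := profile_of a z; have [q [qb qz]] := profile_of b z.
rewrite -pa -qb; apply: (A_convex p q s) => //.
  by apply: (boxRV_others (i := i)); rewrite ?pa ?pz.
by apply: (boxRV_others (i := i)); rewrite ?qb ?qz.
Qed.

Lemma measurable_box_others :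
  measurable (box_others Th : set (borel (others_profile R (tdim G) i))).
Proof.
apply: closed_borel_measurable; apply: boxRV_closed => j.
by apply: compact_closed; [exact: norm_hausdorff | exact: types_compact].
Qed.

Lemma measurable_type_coord (j : others i) (l : 'I_(tdim G (val j))) :
  measurable_fun setT (fun x : borel (others_profile R (tdim G) i) =>
    (x : others_profile R (tdim G) i) j ord0 l).
Proof.
apply: borel_measurable_fun; apply: continuous_borel_measurable.
rewrite (_ : (fun _ => _) = (fun y : 'rV[R]_(tdim G (val j)) => y ord0 l) \o
  (@proj _ (fun j : others i => 'rV[R]_(tdim G (val j))) j))//.
move=> x; apply: continuous_comp; first exact: proj_continuous.
exact: coord_continuous.
Qed.

Lemma measurable_action_coord (f : others_strategy G i) (j : others i)
    (l : 'I_(adim G (val j))) : others_strategies f ->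
  measurable_fun (box_others Th : set (borel (others_profile R (tdim G) i)))
    (fun x : borel (others_profile R (tdim G) i) =>
      play f (x : others_profile R (tdim G) i) j ord0 l).
Proof.
move=> Ff; have [_ mf] := Ff j.
have mTh : measurable (Th (val j) : set (borel 'rV[R]_(tdim G (val j)))).
  apply: closed_borel_measurable.
  by apply: compact_closed; [exact: norm_hausdorff | exact: types_compact].
have mp : measurable_fun setT
    (@proj _ (fun j : others i => 'rV[R]_(tdim G (val j))) j
     : borel (others_profile R (tdim G) i) -> borel 'rV[R]_(tdim G (val j))).
  by apply: continuous_borel_measurable; exact: proj_continuous.
have mc : measurable_fun setT
    (fun y : borel 'rV[R]_(adim G (val j)) =>
      (y : 'rV[R]_(adim G (val j))) ord0 l).
  apply: borel_measurable_fun; apply: continuous_borel_measurable.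
  exact: coord_continuous.
apply: (measurableT_comp mc).
apply: (measurable_comp mTh _ mf); last exact: measurable_funTS.
by move=> _ [x Tx <-]; exact: Tx.
Qed.

Section expected_utility.
Hypothesis u_lip : lipschitz_utility G i.
Variables (f : others_strategy G i) (t : 'rV[R]_(tdim G i)).
Hypotheses (Ff : others_strategies f) (Tt : Th i t).
Local Notation X := (borel (others_profile R (tdim G) i)).
Local Notation B := (box_others Th : set X).
Local Notation mu := (belief G i t).
Local Notation ut a := (fun x : X => u a (play f x) t x).

Lemma play_box_others x : box_others Th x -> box_others A (play f x).
Proof. by move=> Tx j; have [+ _] := Ff j; apply; exact: Tx. Qed.

(** By the Lipschitz condition the integrand is continuous in the coordinates
    of the types and of the actions that the strategies prescribe; the index
    type [C] lists these two kinds of coordinates. *)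
Lemma measurable_utility a : A i a -> measurable_fun B (ut a).
Proof.
move=> Aa; have [K K0 uK] := utility_lipschitz_supnorm u_lip.
pose C := ({j : others i & 'I_(adim G (val j))} +
           {j : others i & 'I_(tdim G (val j))})%type.
pose phi (c : C) (x : X) : R :=
  match c with
  | inl c => play f x (tag c) ord0 (tagged c)
  | inr c => (x : others_profile R (tdim G) i) (tag c) ord0 (tagged c)
  end.
apply: (@measurable_fun_of_coords _ _ _ C _ phi).
- exact: measurable_box_others.
- move=> [[j l]|[j l]]; first exact: measurable_action_coord.
  by apply: measurable_funTS; exact: measurable_type_coord.
move=> x e Bx e0; exists (e / K) => [|y By phir]; first exact: divr_gt0.
have r0 : 0 <= e / K by rewrite ltW// divr_gt0.
rewrite -(divfK (lt0r_neq0 K0) e) [leRHS]mulrC.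
apply: uK => //; [exact: play_box_others|exact: play_box_others| | |].
- by rewrite subrr normr0.
- move=> j; apply/rv_norm_leP => // l; rewrite !mxE.
  exact: (phir (inl (Tagged (fun j : others i => 'I_(adim G (val j))) l))).
- move=> j; apply/rv_norm_leP => // l; rewrite !mxE.
  exact: (phir (inr (Tagged (fun j : others i => 'I_(tdim G (val j))) l))).
Qed.

(** Boundedness: the boxes of types and actions have finite diameter, so the
    Lipschitz condition bounds the distance of the integrand to its value at
    one reference point [z]. *)
Lemma integrable_utility a : A i a -> mu.-integrable B (EFin \o ut a).
Proof.
move=> Aa; have [K K0 uK] := utility_lipschitz_supnorm u_lip.
have [M M0 AM] := compact_boxRV_bounded (@actions_compact _ _ G).
have [N N0 ThN] := compact_boxRV_bounded (@types_compact _ _ G).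
have diam k (S : forall j, set 'rV[R]_(k j)) c : (forall j, S j !=set0) ->
    (forall x, boxRV S x -> forall j, `|x j| <= c) ->
    forall x y : others_profile R k i, box_others S x -> box_others S y ->
    forall j, `|x j - y j| <= c + c.
  move=> /(_ i)[s Ss] Sc x y Sx Sy j.
  have bound z : box_others S z -> `|z j| <= c.
    move=> Sz; have [p [ps pz]] := profile_of s z.
    rewrite -pz; apply: (Sc p); apply: (boxRV_others (i := i)).
      by rewrite ps.
    by rewrite pz.
  by rewrite (le_trans (ler_normB _ _))// lerD// bound.
apply: measurable_bounded_integrable.
- exact: measurable_box_others.
- by rewrite [X in (X < _)%E](belief_types _ _ _ _ _ Tt) ltry.
- exact: measurable_utility.
pose z : others_profile R (tdim G) i :=
  fun j => projT1 (cid (@types_neq0 _ _ G (val j))).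
have Bz : box_others Th z by move=> j; rewrite /z; case: cid.
exists (K * (M + M + (N + N)) + `|ut a z|); split; first exact: num_real.
move=> c /ltW Mc x /= Bx; apply: le_trans Mc.
rewrite -lerBlDr; apply: le_trans (lerB_dist _ _) _.
apply: uK => //; [exact: play_box_others|exact: play_box_others| | |].
- by rewrite subrr normr0 !addr_ge0.
- move=> j; apply: (@le_trans _ _ (M + M)); last by rewrite lerDl addr_ge0.
  by apply: (diam _ _ _ (@actions_neq0 _ _ G) AM); exact: play_box_others.
- move=> j; apply: (@le_trans _ _ (N + N)); last by rewrite lerDr addr_ge0.
  exact: (diam _ _ _ (@types_neq0 _ _ G) ThN).
Qed.

Lemma integrable_belief_cst (c : R) : mu.-integrable B (EFin \o cst c).
Proof.
by apply: finite_measure_integrable_cst; exact: measurable_box_others.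
Qed.

Lemma Rintegral_belief_cst (c : R) : \int[mu]_(x in B) c = c.
Proof.
rewrite Rintegral_cst; last exact: measurable_box_others.
by rewrite [X in fine X](belief_types _ _ _ _ _ Tt) mulr1.
Qed.

(** Two own actions leave all other arguments of the utility equal, so the
    pointwise bound is a constant and integrates to itself. *)
Lemma rho_lipschitz :
  exists2 K, 0 < K & forall a a', A i a -> A i a' ->
    `|rho a f t - rho a' f t| <= K * `|a - a'|.
Proof.
have [K K0 uK] := utility_lipschitz_supnorm u_lip; exists K => // a a' Aa Aa'.
have mB := measurable_box_others.
have ia := integrable_utility Aa; have ia' := integrable_utility Aa'.
rewrite /rho -RintegralB//.
have iB := integrableB mB ia ia'.
apply: le_trans (le_normr_Rintegral _ _) _ => //.
rewrite -[leRHS]Rintegral_belief_cst; apply: le_Rintegral => //.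
- exact: integrable_norm.
- exact: integrable_belief_cst.
move=> x Bx.
apply: uK => //; [exact: play_box_others|exact: play_box_others| |].
- by move=> j; rewrite subrr normr0.
- by move=> j; rewrite subrr normr0.
Qed.

Lemma opt_actions_neq0 : opt_actions f t !=set0.
Proof.
have [K K0 rK] := rho_lipschitz.
have [|a Aa amax] := compact_EVT_max (f := fun a => rho a f t)
    (@actions_neq0 _ _ G i) (@actions_compact _ _ G i).
  apply/subspace_continuousP => a Aa; apply/cvgrPdist_le => e e0.
  have nb : \forall b \near a, `|a - b| <= e / K.
    have /cvgrPdist_le : x @[x --> a] --> a by exact: cvg_id.
    by apply; rewrite divr_gt0.
  apply: filterS nb => b ab Ab; apply: le_trans (rK _ _ Aa Ab) _.
  by rewrite mulrC -ler_pdivlMr.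
exists a; split; first exact/set_mem.
by move=> b Ab; apply: amax; exact/mem_set.
Qed.

(** The concavity inequality integrates term by term; its quadratic term does
    not depend on the types, hence is unchanged because the belief has total
    mass 1 on the box. *)
Lemma rho_strongly_concave (sigma : R) : convex_action_profiles G ->
  (forall x, box_others Th x ->
    strongly_concave_on (A i) sigma (fun a => u a (play f x) t x)) ->
  strongly_concave_on (A i) sigma (fun a => rho a f t).
Proof.
move=> A_convex uc a a' s Aa Aa' s01.
have Am := convex_actions A_convex Aa' Aa s01.
have mB := measurable_box_others.
have ia := integrable_utility Aa; have ia' := integrable_utility Aa'.
have isa : mu.-integrable B (EFin \o (fun x => (1 - s) * ut a x)).
  exact: (integrableZl mB (1 - s) ia).
have isa' : mu.-integrable B (EFin \o (fun x => s * ut a' x)).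
  exact: (integrableZl mB s ia').
have isum := integrableD mB isa' isa.
have ic :=
  integrable_belief_cst (sigma / 2 * s * (1 - s) * enorm (a' - a) ^+ 2).
rewrite /rho -!RintegralZl// -RintegralD//.
rewrite -[X in _ + X <= _]Rintegral_belief_cst.
rewrite -RintegralD//; apply: le_Rintegral => //.
- exact: (integrableD mB isum ic).
- exact: integrable_utility.
by move=> x Bx; exact: uc.
Qed.

End expected_utility.

Lemma opt_growth (sigma : R) (f : others_strategy G i) (t : 'rV[R]_(tdim G i))
    (a : 'rV[R]_(adim G i)) :
  convex_action_profiles G -> 0 <= sigma ->
  strongly_concave_on (A i) sigma (fun a => rho a f t) ->
  opt_actions f t !=set0 -> A i a ->
  rho a f t + sigma / 4 * dist_set a (opt_actions f t) ^+ 2 <= opt_value f t.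
Proof.
move=> A_convex sigma0 rc [b [Ab bmax]] Aa.
have cA x y s (Ax : A i x) (Ay : A i y) (s01 : 0 <= s <= 1) :=
  convex_actions A_convex Ax Ay s01.
have db : dist_set a (opt_actions f t) <= enorm (a - b).
  apply: ge_inf; last by exists b.
  by exists 0 => _ [c _ <-]; exact: enorm_ge0.
have d0 : 0 <= dist_set a (opt_actions f t).
  apply: lb_le_inf; first by exists (enorm (a - b)), b.
  by move=> _ [c _ <-]; exact: enorm_ge0.
apply: (@le_trans _ _ (rho b f t)); last first.
  apply: ub_le_sup; last by exists b.
  by exists (rho b f t) => _ [c Ac <-]; exact: bmax.
apply: le_trans (strongly_concave_growth cA rc Ab bmax Aa).
rewrite lerD2l ler_wpM2l ?divr_ge0//.
by rewrite lerXn2r ?nnegrE ?enorm_ge0.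
Qed.

(** The modulus of concavity is uniform in the strategies and the types, and
    the constant of quadratic growth depends on nothing else. *)
Lemma second_order_growth :
  lipschitz_utility G i -> strongly_concave_utility G i ->
  convex_action_profiles G ->
  exists2 alpha : R, 0 < alpha &
    forall (f : others_strategy G i) (t : 'rV[R]_(tdim G i)),
      others_strategies f -> Th i t ->
      opt_actions f t !=set0 /\
      forall a : 'rV[R]_(adim G i), A i a ->
        rho a f t + alpha * dist_set a (opt_actions f t) ^+ 2 <= opt_value f t.
Proof.
move=> u_lip [sigma sigma0 uc] A_convex.
exists (sigma / 4); first by rewrite divr_gt0.
move=> f t Ff Tt; have opt0 := opt_actions_neq0 u_lip Ff Tt.
split=> // a Aa; apply: opt_growth => //; first exact: ltW.
apply: rho_strongly_concave => // x Tx b b' s Ab Ab' s01.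
have [p [pt px]] := profile_of t x.
have := uc f p Ff; rewrite pt px; apply => //.
by apply: (boxRV_others (i := i)); rewrite ?pt ?px.
Qed.

End game_lemmas.

(* Nonemptiness of the argmax says that the maximum defining v_i exists. *)
Theorem proposition3p1 (R : realType) (n : nat) (G : bayesian_game R n)
    (u_lipschitz : forall i, lipschitz_utility G i)
    (u_concave : forall i, strongly_concave_utility G i)
    (A_convex : convex_action_profiles G) :
  exists2 alpha : R, 0 < alpha &
    forall (i : 'I_n) (f : others_strategy G i) (t : 'rV[R]_(tdim G i)),
      others_strategies f -> types G i t ->
      opt_actions f t !=set0 /\
      forall a' : 'rV[R]_(adim G i), actions G i a' ->
        - rho a' f t >=
          - opt_value f t + alpha * dist_set a' (opt_actions f t) ^+ 2.
Proof.
pose growth i := second_order_growth (u_lipschitz i) (u_concave i) A_convex.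
have /choice[alpha alphaP] i : exists c : R, 0 < c /\
    forall (f : others_strategy G i) t, others_strategies f -> types G i t ->
    opt_actions f t !=set0 /\ forall a, actions G i a ->
      rho a f t + c * dist_set a (opt_actions f t) ^+ 2 <= opt_value f t.
  by have [c c0 cP] := growth i; exists c.
exists (\big[Order.min/1]_i alpha i).
  by rewrite lt_bigmin// => i _; case: (alphaP i).
move=> i f t Ff Tt; have [_ /(_ f t Ff Tt)[opt0 growth_i]] := alphaP i.
split=> // a Aa; rewrite lerNr opprD opprK lerBrDr.
apply: le_trans (growth_i a Aa); rewrite lerD2l ler_wpM2r ?sqr_ge0//.
exact: bigmin_le.
Qed.
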